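(* Let $c$ be a positive real number and let $(G_k)$ be a family of finite groups whose orders tend to infinity. Suppose that for every $\varepsilon>0$ we have $f_{G_k}(c-\varepsilon) \to \infty$ as $k \to \infty$. Then for every $\varepsilon > 0$, with probability tending to $1$ as $k\to\infty$, the diameter of $\Gamma \in \mathcal{G}\bigl(G_k, \sqrt{(c-\varepsilon)\log|G_k|/|G_k|}\bigr)$ is greater than 2.
   Context: For a finite group $G$ and a subset $S \subseteq G$, the Cayley graph $\Gamma(G;S)$ has vertex set $G$ and an edge between distinct $g,h$ if and only if $hg^{-1} \in S$ or $gh^{-1} \in S$ (loops and multiple edges ignored). The random model $\mathcal{G}(G,p)$ is the probability space of graphs $\Gamma(G;S)$ where each element of $G$ is put in $S$ independently with probability $p$. The diameter of a disconnected graph is infinite. Dependency graphs: for a finite group $G$ and a non-identity $x \in G$, $\Gamma_x$ is the graph with vertex set $G$ in which $g$ is adjacent to $h$ iff $h \in \{xg, xg^{-1}, x^{-1}g, x^{-1}g^{-1}, gx, gx^{-1}, g^{-1}x, g^{-1}x^{-1}\}$; loops are allowed, multiple edges are ignored. For such a graph $\Gamma$, $\ell(\Gamma)$ is the number of loops and $e(\Gamma)$ the number of edges that are not loops. Write $n=|G|$. Define $g_G(x) = n^{-e(\Gamma_x)/n}$; $h_G(x) = \exp\bigl(-\sqrt{\tfrac{\log n}{n}}\,\ell(\Gamma_x)\bigr)$ if $x^2=1$ and $h_G(x) = \exp\bigl(-2\sqrt{\tfrac{\log n}{n}}\,\ell(\Gamma_x)\bigr)$ if $x^2\neq 1$; for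 $c>0$, $f_G(x;c) = g_G(x)^c h_G(x)^{\sqrt{c}}$ and $f_G(c) = \sum_{x \in G\setminus\{1\}} f_G(x;c)$. *)

(* Defs.v *)
From HB Require Import structures.
From mathcomp Require Import all_boot all_order all_algebra all_fingroup.
From mathcomp Require Import all_classical all_reals all_analysis.

Set Implicit Arguments.
Unset Strict Implicit.
Unset Printing Implicit Defensive.

Import Order.TTheory GRing.Theory Num.Theory.
Import numFieldNormedType.Exports.

Local Open Scope classical_set_scope.
Local Open Scope ring_scope.

Section GraphMetric.
Variables (R : realType) (T : finType).
Implicit Types (e : rel T) (u v : T).

(* The infimum of the empty set is +oo, so vertices in different components are
   at infinite distance. *)
Definition graph_dist e u v : \bar R :=
  ereal_inf [set z | exists2 s : seq T,
    path e u s /\ last u s = v & z = ((size s)%:R)%:E].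

Definition graph_diameter e : \bar R :=
  ereal_sup [set z | exists u v : T, z = graph_dist e u v].

End GraphMetric.

Definition nloops (T : finType) (e : rel T) : nat := #|[set u : T | e u u]%SET|.

(* For a symmetric e: edges are counted as unordered pairs. *)
Definition nedges (T : finType) (e : rel T) : nat :=
  #|[set A : {set T} | [exists u, exists v,
       [&& u != v, e u v & A == [set u; v]%SET]]]%SET|.

Section Cayley.
Variable gT : finGroupType.
Implicit Types (S : {set gT}) (x g h : gT).

Definition cayley_graph S : rel gT :=
  fun g h => (g != h) && ((h * g^-1 \in S) || (g * h^-1 \in S))%g.

Definition dependency_graph x : rel gT :=
  fun g h => h \in [:: x * g; x * g^-1; x^-1 * g; x^-1 * g^-1;
                       g * x; g * x^-1; g^-1 * x; g^-1 * x^-1]%g.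

End Cayley.

Section RandomCayley.
Variables (R : realType) (gT : finGroupType).
Implicit Types (p c : R) (x : gT).

(* Probability that a random subset of gT, containing each element independently
   with probability p, satisfies E. It is a probability only when 0 <= p <= 1. *)
Definition random_subset_Pr p (E : pred {set gT}) : R :=
  \sum_(S : {set gT} | E S)
    \prod_(x : gT) (if x \in S then p else 1 - p).

Local Notation n := (#|gT|%:R : R).

Definition gG x : R := n `^ (- ((nedges (dependency_graph x))%:R / n)).

Definition hG x : R :=
  let l : R := (nloops (dependency_graph x))%:R in
  if (x ^+ 2 == 1)%g then expR (- (Num.sqrt (ln n / n) * l))
  else expR (- (2 * Num.sqrt (ln n / n) * l)).

Definition fGx x c : R := gG x `^ c * hG x `^ Num.sqrt c.

Definition fG c : R := \sum_(x : gT | x != 1%g) fGx x c.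

Definition inclusion_prob c : R := Num.sqrt (c * ln n / n).

End RandomCayley.
Arguments fG {R} gT c.
Arguments inclusion_prob {R} gT c.
Arguments random_subset_Pr {R gT} p E.

(* Main.v *)
Require Import Defs.
From mathcomp Require Import all_boot all_order all_algebra all_fingroup.
From mathcomp Require Import all_classical all_reals all_analysis.
From mathcomp Require Import ring lra.

(** Second moment method.  For [x != 1], the distance between [1] and [x] exceeds
    [2] as soon as the random set avoids [x], [x^-1], the loops of the dependency
    graph of [x], and does not contain both ends of one of its edges.  Harris'
    inequality bounds the probability of this event from below by a product over
    loops and edges, which beats [fGx x (c - eps / 2)] by a factor close to
    [n `^ (eps / 4)], because a dependency graph has at least [n / 2] edges; hence
    the expected number of such [x] grows like a power of [n].  Janson's argument
    shows that the events for [x] and [y] are almost independent unless the two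
    dependency graphs share more than [n / ln n ^ 2] edges; since an edge lies in
    at most eight dependency graphs, every [x] has only [O(ln n ^ 2)] exceptional
    partners [y], and Chebyshev's inequality concludes.  Elements [x] with more
    than about [sqrt (n ln n)] loops are discarded: they contribute at most [1]
    to [fG]. *)

Set Implicit Arguments.
Unset Strict Implicit.
Unset Printing Implicit Defensive.

Import Order.TTheory GRing.Theory Num.Theory.
Import numFieldNormedType.Exports.

Local Open Scope ring_scope.

(** * Random subsets *)

Section RandomSubset.
Variables (R : realType) (T : finType) (p : R).
Implicit Types (S A B : {set T}) (f g : {set T} -> R) (F : {set {set T}}).

Definition subset_weight S : R := \prod_(x : T) (if x \in S then p else 1 - p).

Definition expect f : R := \sum_S subset_weight S * f S.

(** Reveals the elements of [s] one at a time, each kept with probability [p]. This recursive form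
    of [expect] makes induction on the ground set possible. *)
Fixpoint seq_expect (s : seq T) f : R :=
  if s is x :: s' then
    p * seq_expect s' (fun S => f (x |: S)) + (1 - p) * seq_expect s' f
  else f finset.set0.

Lemma eq_seq_expect s f g : f =1 g -> seq_expect s f = seq_expect s g.
Proof.
elim: s f g => [|x s IH] f g fg /=; first exact: fg.
by rewrite (IH _ _ fg) (IH _ (fun S => g (x |: S))) // => S; rewrite fg.
Qed.

Lemma sum_subsetU1 (U : {set T}) x (H : {set T} -> R) : x \notin U ->
  \sum_(S : {set T} | S \subset x |: U) H S =
  \sum_(S : {set T} | S \subset U) H (x |: S) + \sum_(S : {set T} | S \subset U) H S.
Proof.
move=> xU; rewrite (bigID (fun S : {set T} => x \in S)) /=; congr +%R.
- rewrite (reindex_onto (fun S => x |: S) (fun S => S :\ x)) /=; last first.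
    by move=> S /andP[_ xS]; rewrite finset.setD1K.
  apply: eq_bigl => S; rewrite !inE eqxx andbT.
  apply/andP/idP => [[h /eqP e]|h].
    rewrite -e; apply/fintype.subsetP => y; rewrite !inE => /andP[yx].
    by rewrite (negbTE yx) /= => yS; move/fintype.subsetP/(_ y): h; rewrite !inE yS (negbTE yx) orbT; apply.
  split; first exact: finset.setUS.
  apply/eqP; apply: finset.setU1K; apply: contra xU; exact: (fintype.subsetP h).
- apply: eq_bigl => S; apply/andP/idP => [[h xS]|h].
    apply/fintype.subsetP => y yS; move/fintype.subsetP/(_ y yS): h.
    by rewrite !inE => /orP[/eqP yx|//]; rewrite -yx yS in xS.
  split; first exact: fintype.subset_trans h (finset.subsetU1 _ _).
  by apply: contra xU; apply: (fintype.subsetP h).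
Qed.

Lemma seq_expectE s f : uniq s ->
  seq_expect s f = \sum_(S : {set T} | S \subset [set y in s]%SET)
    (\prod_(x <- s) (if x \in S then p else 1 - p)) * f S.
Proof.
elim: s f => [|x s IH] f /=.
  move=> _; rewrite (big_pred1 finset.set0) ?big_nil ?mul1r // => S.
  by rewrite /= -finset.subset0; congr (_ \subset _); apply/setP => y; rewrite !inE.
move=> /andP[xs us]; rewrite !IH //.
have -> : [set y in x :: s]%SET = x |: [set y in s]%SET.
  by apply/setP => y; rewrite !inE.
have xU : x \notin [set y in s]%SET by rewrite inE.
rewrite sum_subsetU1 // !big_distrr /=; congr +%R; apply: eq_bigr => S SU.
  rewrite big_cons !inE eqxx /= mulrA; congr (_ * _ * _); apply: eq_big_seq => y ys.
  by rewrite !inE; case: eqVneq ys xs => [->->|].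
rewrite big_cons mulrA.
by rewrite (negbTE (contra (fintype.subsetP SU x) xU)).
Qed.

Lemma expectE f : expect f = seq_expect (enum T) f.
Proof.
rewrite seq_expectE ?enum_uniq // /expect.
apply: eq_big => [S|S _].
  by apply/esym/fintype.subsetP => y _; rewrite inE mem_enum.
by rewrite /subset_weight big_enum.
Qed.

Lemma eq_expect f g : f =1 g -> expect f = expect g.
Proof. by move=> fg; apply: eq_bigr => S _; rewrite fg. Qed.

Lemma expectD f g : expect (fun S => f S + g S) = expect f + expect g.
Proof. by rewrite -big_split; apply: eq_bigr => S _; rewrite mulrDr. Qed.

Lemma expectZ (a : R) f : expect (fun S => a * f S) = a * expect f.
Proof. by rewrite big_distrr; apply: eq_bigr => S _ /=; rewrite mulrCA. Qed.

Lemma expect_sum (I : finType) (P : pred I) (f : I -> {set T} -> R) :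
  expect (fun S => \sum_(i | P i) f i S) = \sum_(i | P i) expect (f i).
Proof.
by rewrite exchange_big; apply: eq_bigr => S _; rewrite big_distrr.
Qed.

Lemma seq_expect_cst s (a : R) : seq_expect s (fun=> a) = a.
Proof. by elim: s => //= x s IH; rewrite IH; ring. Qed.

Lemma expect_cst (a : R) : expect (fun=> a) = a.
Proof. by rewrite expectE seq_expect_cst. Qed.

Lemma seq_expect_mem s x f : uniq s -> x \in s ->
  seq_expect s (fun S => (x \in S)%:R * f S) = p * seq_expect s (fun S => f (x |: S)).
Proof.
(* A random set drawn from a list without [x] never contains [x]. *)
have nin s' g : x \notin s' -> seq_expect s' (fun S => (x \in S)%:R * g S) = 0.
  elim: s' g => [|y s' IH] g /=; first by rewrite inE mul0r.
  rewrite inE negb_or => /andP[xy xs]; rewrite IH // mulr0 addr0.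
  rewrite (eq_seq_expect _ (g := fun S => (x \in S)%:R * g (y |: S))) ?IH ?mulr0 //.
  by move=> S; rewrite !inE (negbTE xy).
elim: s f => [//|y s IH] f /= /andP[ys us]; rewrite inE.
case: (eqVneq x y) ys => [<-|xy] ys /= xs.
  rewrite nin // mulr0 addr0.
  rewrite (eq_seq_expect _ (g := fun S => f (x |: S))); last first.
    by move=> S; rewrite !inE eqxx mul1r.
  rewrite [in RHS](eq_seq_expect _ (f := fun S => f (x |: (x |: S)))
     (g := fun S => f (x |: S))); last by move=> S; rewrite finset.setUA finset.setUid.
  by ring.
rewrite IH //.
rewrite (eq_seq_expect _ (g := fun S => (x \in S)%:R * f (y |: S))); last first.
  by move=> S; rewrite !inE (negbTE xy).
rewrite IH // (eq_seq_expect _ (f := fun S => f (y |: (x |: S)))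
  (g := fun S => f (x |: (y |: S)))); first by ring.
by move=> S; rewrite finset.setUCA.
Qed.

(** Membership of the elements outside [A] is independent of the event [A \subset S], so
    conditioning on it replaces [S] by [A :|: S]. The elements of [A] are forced in one by one. *)
Lemma expect_sub A f :
  expect (fun S => (A \subset S)%:R * f S) = p ^+ #|A| * expect (fun S => f (A :|: S)).
Proof.
move En : #|A| => n; elim: n A f En => [|n IH] A f En.
  move/eqP: En; rewrite cards_eq0 => /eqP ->; rewrite expr0 mul1r.
  by apply: eq_expect => S; rewrite finset.sub0set mul1r finset.set0U.
have /card_gt0P[x xA] : (0 < #|A|)%N by rewrite En.
have En' : #|A :\ x| = n by apply/eqP; rewrite -eqSS -En [in #|A|](cardsD1 x) xA.
rewrite (eq_expect (g := fun S => (A :\ x \subset S)%:R * ((x \in S)%:R * f S))); last first.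
  move=> S; rewrite mulrA -natrM mulnb; congr (_%:R * _).
  by rewrite -[in LHS](finset.setD1K xA) finset.subUset finset.sub1set andbC.
rewrite IH //.
rewrite (eq_expect (g := fun S => (x \in S)%:R * f (A :\ x :|: S))); last first.
  by move=> S; rewrite !inE eqxx.
rewrite expectE seq_expect_mem ?enum_uniq ?mem_enum // -expectE mulrA -exprSr.
by congr (_ * _); apply: eq_expect => S; rewrite finset.setUCA finset.setUA finset.setD1K.
Qed.

(** * Correlation of decreasing functions *)

Hypotheses (p_ge0 : 0 <= p) (p_le1 : p <= 1).

Lemma subset_weight_ge0 S : 0 <= subset_weight S.
Proof. by apply: prodr_ge0 => x _; case: ifP; rewrite ?subr_ge0. Qed.

Lemma le_expect f g : (forall S, f S <= g S) -> expect f <= expect g.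
Proof. by move=> fg; apply: ler_sum => S _; rewrite ler_wpM2l ?subset_weight_ge0. Qed.

Lemma le_seq_expect s f g : (forall S, f S <= g S) -> seq_expect s f <= seq_expect s g.
Proof.
elim: s f g => [|x s IH] f g fg /=; first exact: fg.
by apply: lerD; apply: ler_wpM2l; rewrite ?subr_ge0 //; apply: IH.
Qed.

Definition decreasing f := forall S A, S \subset A -> f A <= f S.

Lemma decreasingU1 x f : decreasing f -> decreasing (fun S => f (x |: S)).
Proof. by move=> df S A SA; apply: df; apply: finset.setUS. Qed.

(** Induction on the revealed elements. With index 1 or 0 for [x] inside or outside the set, the
    mean of the products exceeds the product of the means by
    [p * (1 - p) * ((f0 - f1) * (g0 - g1))], and both differences are nonnegative by
    monotonicity. *)
Lemma harris f g : decreasing f -> decreasing g ->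
  expect f * expect g <= expect (fun S => f S * g S).
Proof.
rewrite !expectE; move: (enum T) => s df dg.
elim: s f g df dg => [|x s IH] f g df dg //=.
have := IH _ _ (decreasingU1 x df) (decreasingU1 x dg).
have := IH _ _ df dg.
have lef h : decreasing h -> seq_expect s (fun S => h (x |: S)) <= seq_expect s h.
  by move=> dh; apply: le_seq_expect => S; apply: dh; apply: finset.subsetUr.
move: (lef _ df) (lef _ dg).
set f1 := seq_expect s (fun S => f (x |: S)); set f0 := seq_expect s f.
set g1 := seq_expect s (fun S => g (x |: S)); set g0 := seq_expect s g.
set h1 := seq_expect s (fun S => _ (x |: S) * _); set h0 := seq_expect s _.
move=> f10 g10 H0 H1.
have K : 0 <= p * (1 - p) * ((f0 - f1) * (g0 - g1)).
  by rewrite !mulr_ge0 ?subr_ge0.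
have L1 : p * (f1 * g1) <= p * h1 by rewrite ler_wpM2l.
have L0 : (1 - p) * (f0 * g0) <= (1 - p) * h0 by rewrite ler_wpM2l ?subr_ge0.
apply: le_trans (lerD L1 L0).
rewrite -subr_ge0; apply: le_trans K _; rewrite le_eqVlt; apply/orP; left; apply/eqP.
by ring.
Qed.

(** * Probability of containing no member of a family of sets *)

Definition avoids F S : bool := [forall A in F, ~~ (A \subset S)].

Lemma avoidsP F S : reflect (forall A, A \in F -> ~~ (A \subset S)) (avoids F S).
Proof. exact: forall_inP. Qed.

Lemma avoids_decr F : decreasing (fun S => (avoids F S)%:R).
Proof.
move=> S A SA; rewrite ler_nat; case: avoidsP => // h.
by case: avoidsP => // -[] B BF; apply: contra (h B BF) => /fintype.subset_trans; apply.
Qed.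

Lemma avoidsU F (F' : {set {set T}}) S : avoids (F :|: F') S = avoids F S && avoids F' S.
Proof.
apply/avoidsP/andP => [h|[/avoidsP h /avoidsP h'] A].
  by split; apply/avoidsP => A AF; apply: h; rewrite inE AF ?orbT.
by rewrite inE => /orP[/h|/h'].
Qed.

Lemma avoids1 A S : avoids [set A]%SET S = ~~ (A \subset S).
Proof.
by apply/avoidsP/idP => [->|h B]; rewrite ?inE ?eqxx // => /eqP ->.
Qed.

Definition avoid_prob F : R := expect (fun S => (avoids F S)%:R).

Lemma avoid_prob_ge0 F : 0 <= avoid_prob F.
Proof. by rewrite -(expect_cst 0); apply: le_expect => S; rewrite ler0n. Qed.

Lemma expect_subE A : expect (fun S => (A \subset S)%:R) = p ^+ #|A|.
Proof.
rewrite (eq_expect (g := fun S => (A \subset S)%:R * 1)) => [|S]; last by rewrite mulr1.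
by rewrite expect_sub expect_cst mulr1.
Qed.

Lemma avoid_prob1 A : avoid_prob [set A]%SET = 1 - p ^+ #|A|.
Proof.
rewrite /avoid_prob (eq_expect (g := fun S => 1 + (- 1) * (A \subset S)%:R)); last first.
  by move=> S; rewrite avoids1; case: (A \subset S) => /=; ring.
by rewrite expectD expect_cst expectZ expect_subE mulN1r.
Qed.

Lemma avoid_prob_mul F F' : avoid_prob F * avoid_prob F' <= avoid_prob (F :|: F').
Proof.
apply: le_trans (harris (@avoids_decr F) (@avoids_decr F')) _.
by apply: le_expect => S; rewrite avoidsU -natrM mulnb.
Qed.

Lemma avoid_prob0 : avoid_prob finset.set0 = 1.
Proof.
rewrite -(expect_cst 1); apply: eq_expect => S.
by have -> : avoids finset.set0 S by apply/avoidsP => A; rewrite inE.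
Qed.

(** Avoiding each single set is a decreasing event, so Harris' inequality splits off one factor at a
    time. *)
Lemma avoid_prob_ge F : \prod_(A in F) (1 - p ^+ #|A|) <= avoid_prob F.
Proof.
move En : #|F| => n; elim: n F En => [|n IH] F En.
  by move/eqP: En; rewrite cards_eq0 => /eqP ->; rewrite big_set0 avoid_prob0.
have /card_gt0P[A AF] : (0 < #|F|)%N by rewrite En.
have En' : #|F :\ A| = n by apply/eqP; rewrite -eqSS -En [in #|F|](cardsD1 A) AF.
rewrite (big_setD1 A AF) /= -(avoid_prob1 A) -[in X in _ <= X](finset.setD1K AF).
apply: le_trans (avoid_prob_mul _ _).
by rewrite ler_wpM2l ?avoid_prob_ge0 ?IH.
Qed.

(* The inductive step of Janson's inequality: conditioning on A being contained
   in S replaces each B by B minus A, and Harris' inequality decouples the B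
   meeting A from the others. *)
Lemma avoid_prob_step A F : A \notin F ->
  avoid_prob (A |: F) <= avoid_prob F *
    (1 - p ^+ #|A| * (1 - \sum_(B in F | B :&: A != finset.set0) p ^+ #|B :\: A|)).
Proof.
move=> AF; set s := \sum_(B in F | _) _.
pose F1 := [set B in F | B :&: A != finset.set0]%SET.
pose F0 := [set B in F | B :&: A == finset.set0]%SET.
have -> : avoid_prob (A |: F) =
  avoid_prob F - expect (fun S => (A \subset S)%:R * (avoids F S)%:R).
  apply/eqP; rewrite eq_sym subr_eq -expectD; apply/eqP/eq_expect => S.
  by rewrite avoidsU avoids1; case: (A \subset S); rewrite /= ?mul1r ?mul0r ?add0r ?addr0.
rewrite expect_sub mulrBr mulr1 lerD2l lerN2 mulrCA ler_wpM2l ?exprn_ge0 //.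
pose g S : R := [forall B in F1, ~~ (B :\: A \subset S)]%:R.
have dg : decreasing g.
  move=> S S' SS'; rewrite ler_nat; case: forall_inP => // h.
  by case: forall_inP => // -[] B BF; apply: contra (h B BF) => /fintype.subset_trans; apply.
(* Union bound over the sets [B :\: A]. *)
have gs : 1 - s <= expect g.
  have -> : 1 - s = expect (fun S => 1 + (-1) * \sum_(B in F | B :&: A != finset.set0) (B :\: A \subset S)%:R).
    rewrite expectD expect_cst expectZ expect_sum mulN1r; congr (_ - _).
    by apply: eq_bigr => B _; rewrite expect_subE.
  apply: le_expect => S; rewrite mulN1r /g; case: forall_inP => [_|h].
    by rewrite lerBlDr lerDl sumr_ge0 // => B _; rewrite ler0n.
  have [B BF BS] : exists2 B, B \in F1 & B :\: A \subset S.
    apply/exists_inP; apply: contraT => /exists_inPn h'; case: h => B BF; exact: h'.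
  move: BF; rewrite inE => BF; rewrite (bigD1 B) //= BS.
  by rewrite lerBlDr add0r lerDl sumr_ge0 // => B' _; rewrite ler0n.
(* Once [A] is inside the set, avoiding [F] follows from two decreasing events: [S] avoids the
   members disjoint from [A], and contains no [B :\: A] for the others. *)
apply: (@le_trans _ _ (avoid_prob F0 * expect g)); last first.
  apply: le_trans (harris (@avoids_decr F0) dg) _.
  apply: le_expect => S; rewrite /g -natrM mulnb ler_nat.
  case: avoidsP => //= h0; case: forall_inP => // h1.
  case: avoidsP => // -[] B BF.
  case: (eqVneq (B :&: A) finset.set0) => BA.
    apply: contra (h0 B _); last by rewrite inE BF BA eqxx.
    move=> BS; apply/fintype.subsetP => y yB; move/fintype.subsetP/(_ y yB): BS.
    by rewrite inE => /orP[yA|//]; have := finset.in_set0 y; rewrite -BA inE yB yA.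
  apply: contra (h1 B _); last by rewrite inE BF BA.
  by rewrite finset.subDset.
apply: (@le_trans _ _ (avoid_prob F * expect g)).
  by rewrite ler_wpM2l ?avoid_prob_ge0.
apply: ler_wpM2r.
  by rewrite -(expect_cst 0); apply: le_expect => S; rewrite ler0n.
apply: le_expect => S; rewrite ler_nat; case: avoidsP => // h.
by case: avoidsP => // -[] B; rewrite inE => /andP[/h].
Qed.

Lemma avoid_prob_anti F F' : F \subset F' -> avoid_prob F' <= avoid_prob F.
Proof.
move=> FF'; apply: le_expect => S; rewrite ler_nat; case: avoidsP => // h.
by case: avoidsP => // -[] B BF; apply: h; apply: (fintype.subsetP FF').
Qed.

(** Distinct singletons are disjoint, so the correction sum of [avoid_prob_step] is empty. *)
Lemma avoid_prob_singletons (L : {set T}) :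
  avoid_prob (finset.set1 @: L)%SET <= (1 - p) ^+ #|L|.
Proof.
move En : #|L| => n; elim: n L En => [|n IH] L En.
  move/eqP: En; rewrite cards_eq0 => /eqP ->; rewrite expr0.
  by rewrite finset.imset0 avoid_prob0.
have /card_gt0P[a aL] : (0 < #|L|)%N by rewrite En.
have En' : #|L :\ a| = n by apply/eqP; rewrite -eqSS -En [in #|L|](cardsD1 a) aL.
rewrite -(finset.setD1K aL) finset.imsetU1.
have aL' : [set a]%SET \notin (finset.set1 @: (L :\ a))%SET.
  by apply/imsetP => -[b]; rewrite !inE => /andP[ba _] /finset.set1_inj ab; rewrite ab eqxx in ba.
apply: le_trans (avoid_prob_step aL') _.
rewrite big_pred0 => [|B]; last first.
  apply/negbTE; rewrite negb_and negbK -implybE; apply/implyP.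
  case/imsetP => b; rewrite !inE => /andP[ba _] ->; apply/eqP/setP => y; rewrite !inE.
  by case: eqVneq => // ->; rewrite (negbTE ba).
by rewrite cards1 expr1 subr0 mulr1 exprSr ler_wpM2r ?subr_ge0 ?IH.
Qed.

(** Janson's bound for a graph of maximal degree [d] with forbidden vertices [L] off its edges.
    Edges are removed one at a time; an edge meets at most [2 * d] others, and each of these
    contributes a single factor [p] to the correction sum. *)
Lemma avoid_prob_le (d : nat) (L : {set T}) F :
  (forall A, A \in F -> #|A| = 2 /\ A :&: L = finset.set0) ->
  (forall u, (#|[set B in F | u \in B]%SET| <= d)%N) ->
  avoid_prob (F :|: (finset.set1 @: L)%SET) <=
    (1 - p) ^+ #|L| * (1 - p ^+ 2 * (1 - (2 * d)%:R * p)) ^+ #|F|.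
Proof.
move En : #|F| => n; elim: n F En => [|n IH] F En hF hd.
  move/eqP: En; rewrite cards_eq0 => /eqP ->; rewrite expr0 mulr1.
  by rewrite finset.set0U avoid_prob_singletons.
have /card_gt0P[A AF] : (0 < #|F|)%N by rewrite En.
have En' : #|F :\ A| = n by apply/eqP; rewrite -eqSS -En [in #|F|](cardsD1 A) AF.
have [A2 AL] := hF A AF.
rewrite -[X in X :|: _](finset.setD1K AF) -finset.setUA.
have h1 B : B \in (finset.set1 @: L)%SET -> B :&: A = finset.set0.
  case/imsetP => b bL ->; apply/setP => y; rewrite !inE.
  case: eqVneq => // ->; apply/negbTE/negP => /= bA.
  by have := finset.in_set0 b; rewrite -AL inE bA bL.
have nA : A \notin (F :\ A) :|: (finset.set1 @: L)%SET.
  rewrite !inE eqxx /=; apply/negP => /h1; rewrite finset.setIid => A0.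
  by rewrite A0 cards0 in A2.
have /card_gt0P[u uA] : (0 < #|A|)%N by rewrite A2.
have A1 : #|A :\ u| = 1%N by move: A2; rewrite (cardsD1 u) uA => -[].
have /card_gt0P[v vA] : (0 < #|A :\ u|)%N by rewrite A1.
have Auv y : y \in A -> y = u \/ y = v.
  move=> yA; case: (eqVneq y u) => [|yu]; [by left|right].
  have /eqP/cards1P[w Aw] := A1.
  have : y \in A :\ u by rewrite !inE yu.
  by move: vA; rewrite Aw !inE => /eqP -> /eqP ->.
apply: le_trans (avoid_prob_step nA) _.
have IH' := IH (F :\ A) En' _ _.
have /IH' {}IH' : forall B, B \in F :\ A -> #|B| = 2 /\ B :&: L = finset.set0.
  by move=> B; rewrite inE => /andP[_ /hF].
have /IH' {}IH' : forall w, (#|[set B in F :\ A | w \in B]%SET| <= d)%N.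
  move=> w; apply: leq_trans (hd w); apply: subset_leq_card.
  by apply/fintype.subsetP => B; rewrite !inE -andbA => /andP[_].
rewrite exprSr mulrA A2.
set s := \sum_(B in _ | _) _.
have s_le : s <= (2 * d)%:R * p.
  (* A set meeting [A] is an edge through [u] or [v]; being different from [A], it has exactly one
     vertex outside [A]. *)
  have hs B : (B \in (F :\ A) :|: (finset.set1 @: L)%SET) && (B :&: A != finset.set0) ->
      (B \in [set B in F | u \in B]%SET :|: [set B in F | v \in B]%SET) /\ #|B :\: A| = 1%N.
    move=> /andP[]; rewrite finset.in_setU => /orP[|/h1 -> /eqP//].
    rewrite finset.in_setD1 => /andP[BA BF] /set0Pn[y]; rewrite !inE BF /= => /andP[yB yA].
    split; first by case: (Auv y yA) => <-; rewrite yB ?orbT.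
    have [B2 _] := hF B BF.
    have : (0 < #|B :\: A|)%N.
      rewrite lt0n cards_eq0 finset.setD_eq0; apply: contra BA => BA.
      by rewrite eqEcard BA A2 B2.
    have : (0 < #|B :&: A|)%N by apply/card_gt0P; exists y; rewrite inE yB.
    by have := cardsID A B; rewrite B2; case: #|B :&: A| => // -[|k]; case: #|B :\: A| => // -[|?] //; rewrite ?addSn ?addnS.
  rewrite /s (eq_bigr (fun=> p)) => [|B /hs [_ ->]]; last by rewrite expr1.
  rewrite sumr_const -[X in X <= _]mulr_natl ler_wpM2r // ler_nat mulSn mul1n.
  apply: leq_trans (leq_add (hd u) (hd v)).
  apply: leq_trans (subset_leq_card _) (leq_card_setU _ _).
  by apply/fintype.subsetP => B /hs[].
apply: (@le_trans _ _ (avoid_prob ((F :\ A) :|: (finset.set1 @: L)%SET) *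
   (1 - p ^+ 2 * (1 - (2 * d)%:R * p)))).
  by rewrite ler_wpM2l ?avoid_prob_ge0 // lerD2l lerN2 ler_wpM2l ?exprn_ge0 // lerD2l lerN2.
apply: ler_wpM2r IH'.
(* Multiplying the induction hypothesis by the last factor requires that factor to be
   nonnegative. *)
rewrite subr_ge0; apply: (@le_trans _ _ (p ^+ 2 * 1)).
  by rewrite ler_wpM2l ?exprn_ge0 // lerBlDr lerDl mulr_ge0.
by rewrite mulr1 exprn_ile1.
Qed.

(** Chebyshev's argument for the number [Y] of avoided families: the indicator of [D] is at least
    [1 - (Y / mu - 1) ^+ 2], whose mean is 2 minus the second moment of [Y / mu]. *)
Lemma second_moment (I : finType) (X : {set I}) (F : I -> {set {set T}})
    (bad : rel I) (D : pred {set T}) (rho b : R) :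
  let mu := \sum_(x in X) avoid_prob (F x) in
  (forall x S, x \in X -> avoids (F x) S -> D S) ->
  (forall x, x \in X -> #|[set y in X | bad x y]%SET|%:R <= b) ->
  (forall x y, x \in X -> y \in X -> ~~ bad x y ->
     avoid_prob (F x :|: F y) <= rho * (avoid_prob (F x) * avoid_prob (F y))) ->
  0 <= rho -> 0 < mu ->
  2 - rho - b / mu <= expect (fun S => (D S)%:R).
Proof.
move=> mu hD hb hrho rho0 mu0.
pose Y S : R := \sum_(x in X) (avoids (F x) S)%:R.
have EY : expect Y = mu by rewrite expect_sum.
have EY2 : expect (fun S => Y S ^+ 2) <= rho * mu ^+ 2 + b * mu.
  rewrite (eq_expect (g := fun S => \sum_(x in X) \sum_(y in X) (avoids (F x :|: F y) S)%:R)); last first.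
    move=> S; rewrite expr2 big_distrlr /=; apply: eq_bigr => x _; apply: eq_bigr => y _.
    by rewrite avoidsU -natrM mulnb.
  rewrite expect_sum.
  have -> : rho * mu ^+ 2 + b * mu =
      \sum_(x in X) avoid_prob (F x) * (rho * mu + b).
    by rewrite -big_distrl /= -/mu; ring.
  apply: ler_sum => x xX; rewrite expect_sum mulrDr.
  rewrite (bigID (bad x)) /= addrC; apply: lerD.
    rewrite mulrCA mulrA big_distrr /= [X in _ <= X](bigID (bad x)) /=.
    rewrite -[X in X <= _]add0r; apply: lerD.
      by apply: sumr_ge0 => y _; rewrite !mulr_ge0 ?avoid_prob_ge0.
    by apply: ler_sum => y /andP[yX xy]; rewrite -mulrA hrho.
  (* For a bad pair the joint probability is bounded by that of [x] alone. *)
  apply: (@le_trans _ _ (\sum_(y in X | bad x y) avoid_prob (F x))).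
    by apply: ler_sum => y _; apply: avoid_prob_anti; apply: finset.subsetUl.
  rewrite sumr_const -[X in X <= _]mulr_natr ler_wpM2l ?avoid_prob_ge0 //.
  by apply: le_trans (hb x xX); rewrite cardsE.
(* The square is expanded so that linearity of [expect] applies term by term. *)
pose Z S : R := 1 + (- mu^-1 ^+ 2 * Y S ^+ 2 + (2 * mu^-1 * Y S + -1)).
have ZD S : Z S <= (D S)%:R.
  have -> : Z S = 1 - (mu^-1 * Y S - 1) ^+ 2 by rewrite /Z; ring.
  case DS: (D S); first by rewrite lerBlDr lerDl sqr_ge0.
  rewrite /Y big1 ?mulr0 ?sub0r => [|x xX]; first by rewrite sqrrN expr1n subrr.
  by case h: (avoids _ _) => //; rewrite (hD x) in DS.
apply: le_trans (le_expect ZD).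
have -> : expect Z = 1 + (- mu^-1 ^+ 2 * expect (fun S => Y S ^+ 2) + (2 * mu^-1 * mu - 1)).
  by rewrite expectD expect_cst expectD expectZ expectD expect_cst expectZ EY.
have -> : 2 * mu^-1 * mu = 2 by rewrite mulfVK ?gt_eqF.
suff : mu^-1 ^+ 2 * expect (fun S => Y S ^+ 2) <= rho + b / mu by rewrite mulNr; lra.
have -> : rho + b / mu = mu^-1 ^+ 2 * (rho * mu ^+ 2 + b * mu).
  by field; rewrite gt_eqF.
by apply: ler_wpM2l EY2; rewrite exprn_ge0 // invr_ge0 ltW.
Qed.

End RandomSubset.

(** * Dependency graphs *)

Section DependencyGraph.
Variable gT : finGroupType.
Implicit Types (x y g h u v : gT) (A B S : {set gT}).
Local Notation dep := (@dependency_graph gT).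

Definition dep_edges x : {set {set gT}} :=
  [set A : {set gT} | [exists u, exists v,
     [&& u != v, dep x u v & A == [set u; v]%SET]]]%SET.

Definition dep_loops x : {set gT} := [set u | dep x u u]%SET.

(** Forbidding [x] and its inverse rules out paths of length one; forbidding the loops rules out
    paths of length two that use one element of the random set twice. *)
Definition dep_forbidden x : {set gT} := (dep_loops x :|: [set x; x^-1%g])%SET.

Definition dep_family x : {set {set gT}} :=
  dep_edges x :|: (finset.set1 @: dep_forbidden x)%SET.

Lemma dep_sym x g h : dep x g h -> dep x h g.
Proof.
rewrite /dependency_graph !inE => H.
by repeat case/orP: H => H; rewrite (eqP H) ?invMg ?invgK ?mulgK ?mulKg ?mulgKV ?mulKVg eqxx ?orbT.
Qed.

Lemma dep_edgesP x A : reflect (exists u v, [/\ u != v, dep x u v & A = [set u; v]%SET])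
  (A \in dep_edges x).
Proof.
rewrite inE; apply: (iffP existsP) => [[u /existsP[v /and3P[? ? /eqP ?]]]|[u [v [? ? ->]]]].
  by exists u, v.
by exists u; apply/existsP; exists v; apply/and3P.
Qed.

Lemma dep_edges_mem x A u : A \in dep_edges x -> u \in A ->
  exists v, [/\ u != v, dep x u v & A = [set u; v]%SET].
Proof.
case/dep_edgesP => a [b [ab xab ->]]; rewrite !inE => /orP[]/eqP ->; first by exists b.
exists a; split; [by rewrite eq_sym | exact: dep_sym | exact: finset.setUC].
Qed.

Lemma card_dep_edge x A : A \in dep_edges x -> #|A| = 2.
Proof. by case/dep_edgesP => u [v [uv _ ->]]; rewrite cards2 uv. Qed.

Lemma dep_degree x u : (#|[set B in dep_edges x | u \in B]%SET| <= 8)%N.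
Proof.
set s := [:: x * u; x * u^-1; x^-1 * u; x^-1 * u^-1;
             u * x; u * x^-1; u^-1 * x; u^-1 * x^-1]%g.
apply: leq_trans (card_size (map (fun v => [set u; v]%SET) s)).
apply: subset_leq_card; apply/fintype.subsetP => B; rewrite inE => /andP[BE uB].
have [v [_ xuv ->]] := dep_edges_mem BE uB.
by apply/mapP; exists v.
Qed.

Lemma card_dep_edges_meet x (L : {set gT}) :
  (#|[set B in dep_edges x | B :&: L != finset.set0]%SET| <= 8 * #|L|)%N.
Proof.
apply: (@leq_trans #|\bigcup_(u in L) [set B in dep_edges x | u \in B]%SET|).
  apply: subset_leq_card; apply/fintype.subsetP => B; rewrite inE => /andP[BE /set0Pn[u]].
  rewrite inE => /andP[uB uL]; apply/bigcupP; exists u => //; by rewrite inE BE.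
rewrite mulnC -sum_nat_const.
elim/big_rec2: _ => [|u m B _ IH]; first by rewrite cards0.
by apply: leq_trans (leq_card_setU _ _) (leq_add (dep_degree x u) IH).
Qed.

Lemma card_dep_edges x : (#|dep_edges x| <= 8 * #|gT|)%N.
Proof.
rewrite -cardsT; apply: leq_trans (card_dep_edges_meet x _).
apply: subset_leq_card; apply/fintype.subsetP => B BE; rewrite inE BE finset.setIT.
by rewrite -card_gt0 (card_dep_edge BE).
Qed.

(** Left multiplication by [x] has no fixed point, so the edges joining [g] to [x * g] cover all
    vertices, each edge covering two. *)
Lemma card_dep_edges_ge x : x != 1%g -> (#|gT| <= 2 * #|dep_edges x|)%N.
Proof.
move=> x1; rewrite -cardsT.
have -> : [set: gT]%SET = finset.cover (dep_edges x).
  apply/esym/eqP; rewrite -finset.subTset; apply/fintype.subsetP => g _.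
  apply/bigcupP; exists [set g; (x * g)%g]%SET; last by rewrite !inE eqxx.
  apply/dep_edgesP; exists g, (x * g)%g; split => //.
    by rewrite -{1}(mul1g g) (inj_eq (mulIg g)) eq_sym.
  by rewrite /dependency_graph !inE eqxx.
apply: leq_trans (leq_card_cover _) _.
rewrite (eq_bigr (fun=> 2%N)) => [|A /card_dep_edge //].
by rewrite sum_nat_const mulnC.
Qed.

(** Double counting: each edge of [x] belongs to at most eight dependency graphs. *)
Lemma sum_dep_edgesI x :
  (\sum_y #|dep_edges x :&: dep_edges y| <= 8 * #|dep_edges x|)%N.
Proof.
rewrite (eq_bigr (fun y => (\sum_(A in dep_edges x) (A \in dep_edges y))%N)); last first.
  move=> y _; rewrite -sum1_card big_mkcond [RHS]big_mkcond; apply: eq_bigr => A _.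
  by rewrite inE; do 2!case: (_ \in _).
rewrite exchange_big /= mulnC -sum_nat_const; apply: leq_sum => A /dep_edgesP[u [v [uv _ ->]]].
(* The eight adjacency equations between [u] and [v], solved for [y]. *)
set s := [:: v * u^-1; v * u; u * v^-1; u^-1 * v^-1; u^-1 * v; u * v; v^-1 * u; v^-1 * u^-1]%g.
rewrite -big_mkcond sum1_card.
apply: leq_trans (card_size s).
apply: subset_leq_card; apply/fintype.subsetP => y yE.
have {yE} : [set u; v]%SET \in dep_edges y by [].
move=> uvE; have [w [uw yuw /setP E]] := dep_edges_mem uvE (finset.set21 u v).
have {w uw E yuw} : dep y u v.
  by have := E w; rewrite !inE eqxx orbT eq_sym (negbTE uw) => /eqP <-.
rewrite /dependency_graph /s !inE => H.
by repeat case/orP: H => H; rewrite (eqP H) ?invMg ?invgK ?mulgK ?mulKg ?mulgKV ?mulKVg eqxx ?orbT.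
Qed.

(** Four of the eight adjacency equations with both ends equal to [g] force [x = 1]; the other four
    give a square. *)
Lemma dep_loopsP x g : x != 1%g -> g \in dep_loops x ->
  (g * g = x)%g \/ (g * g = x^-1)%g.
Proof.
move=> x1; rewrite inE /dependency_graph !inE => H.
have e1 (a b : gT) : (a == b * a)%g = (b == 1)%g.
  by rewrite -{1}(mul1g a) (inj_eq (mulIg a)) eq_sym.
have e2 (a b : gT) : (a == a * b)%g = (b == 1)%g.
  by rewrite -{1}(mulg1 a) (inj_eq (mulgI a)) eq_sym.
move: H; rewrite !e1 !e2 invg_eq1 (negbTE x1) /=.
case/or4P => /eqP E; [left|right|left|right].
- by rewrite {1}E mulgKV.
- by rewrite {1}E mulgKV.
- by rewrite {2}E mulKVg.
- by rewrite {2}E mulKVg.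
Qed.

Lemma card_dep_forbidden x : (#|dep_forbidden x| <= nloops (dep x) + 2)%N.
Proof.
apply: leq_trans (leq_card_setU _ _) _; rewrite leq_add2l.
by rewrite cards2; case: (_ != _).
Qed.

(** A common loop [g] would make [g * g] equal to one of [x], [x^-1] and to one of [y], [y^-1],
    hence [y] equal to [x] or [x^-1]. Only these four elements can be shared. *)
Lemma card_dep_forbiddenI x y : x != 1%g -> y != 1%g -> y != x -> y != x^-1%g ->
  (#|dep_forbidden x :&: dep_forbidden y| <= 4)%N.
Proof.
move=> x1 y1 yx yxV; apply: leq_trans (card_size [:: x; x^-1; y; y^-1]%g).
apply: subset_leq_card; apply/fintype.subsetP => g.
rewrite finset.in_setI !finset.in_setU !finset.in_set1 !inE => /andP[].
case/orP => [gx|/orP[]/eqP -> _]; rewrite ?eqxx ?orbT //.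
case/orP => [gy|/orP[]/eqP ->]; rewrite ?eqxx ?orbT //.
exfalso; move: gx gy; have := @dep_loopsP x g x1; have := @dep_loopsP y g y1.
rewrite !inE => hy hx /hx gx /hy gy; move/eqP: yx; move/eqP: yxV.
case: gx gy => -> [E|E] nV n.
- by apply: n.
- by apply: nV; rewrite E invgK.
- by apply: nV.
- by apply: n; apply: invg_inj.
Qed.

(** Markov's inequality for the overlap sizes; 64 is eight edges per vertex times eight graphs per
    edge. *)
Lemma card_dep_overlap (R : numDomainType) (t : R) x : 0 <= t ->
  #|[set y | t <= #|dep_edges x :&: dep_edges y|%:R]%SET|%:R * t <= 64 * #|gT|%:R.
Proof.
move=> t0; apply: (@le_trans _ _ (\sum_y #|dep_edges x :&: dep_edges y|)%N%:R); last first.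
  rewrite -natrM ler_nat; apply: leq_trans (sum_dep_edgesI x) _.
  by rewrite -[64%N]/(8 * 8)%N -mulnA leq_mul2l /= card_dep_edges.
set P := [set y | _]%SET.
rewrite natr_sum (bigID (fun y => y \in P)) /= -[X in X <= _]addr0; apply: lerD.
  rewrite mulr_natl -sumr_const; apply: ler_sum => y; by rewrite inE.
exact: sumr_ge0.
Qed.

Lemma dep_family_dist x S : x != 1%g -> avoids (dep_family x) S ->
  forall s, path (cayley_graph S) 1%g s -> last 1%g s = x -> (2 < size s)%N.
Proof.
move=> x1 /avoidsP hS.
have hL g : g \in dep_forbidden x -> g \notin S.
  move=> gL; have := hS [set g]%SET; rewrite finset.sub1set; apply.
  by rewrite inE; apply/orP; right; apply: imset_f.
have hE u v : u \in S -> v \in S -> ~~ dep x u v.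
  move=> uS vS; apply/negP => xuv; case: (eqVneq u v) => [uv|uv].
    by move: (hL u); rewrite uS !inE {2}uv xuv => /(_ isT).
  have := hS [set u; v]%SET; rewrite finset.subUset !finset.sub1set uS vS => /(_ _)/negP; apply=> //.
  by rewrite inE; apply/orP; left; apply/dep_edgesP; exists u, v.
have xS : x \notin S by apply: hL; rewrite !inE eqxx orbT.
have xVS : x^-1%g \notin S by apply: hL; rewrite !inE eqxx !orbT.
case=> [|a [|b [|? ?]]] //=.
- by move=> _ e; rewrite -e eqxx in x1.
- rewrite /cayley_graph => + e; rewrite e invg1 mulg1 mul1g (negbTE xS) (negbTE xVS) andbF.
  by [].
(* On a path [1, a, x], the set contains [a] or [a^-1], and [x * a^-1] or its inverse. Each of the
   four combinations is adjacent in the dependency graph. *)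
- move=> + e; rewrite e /cayley_graph andbT invg1 mulg1 mul1g.
  move=> /andP[/andP[_ aS] /andP[_ bS]]; exfalso.
  by case/orP: aS => aS; case/orP: bS => bS; have := hE _ _ aS bS;
    rewrite /dependency_graph !inE ?invMg ?invgK ?mulgK ?mulKg ?mulgKV ?mulKVg eqxx ?orbT.
Qed.

Lemma dep_family_diameter (R : realType) x S : x != 1%g -> avoids (dep_family x) S ->
  (2%:E < graph_diameter R (cayley_graph S))%E.
Proof.
move=> x1 hS; apply: (@lt_le_trans _ _ (3%:E)); first by rewrite lte_fin ltr_nat.
apply: (@le_trans _ _ (graph_dist R (cayley_graph S) 1%g x)).
  apply: le_ereal_inf_tmp => _ [s [ps ls] ->].
  by rewrite lee_fin ler_nat; apply: dep_family_dist ps ls.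
by apply: ereal_sup_ubound; exists 1%g, x.
Qed.

End DependencyGraph.

(** * Probability estimates *)

(** After inversion it is enough that [(1 - q) * (1 + q + 2 * q ^+ 2)], which is
    [1 + q ^+ 2 * (1 - 2 * q)], is at least 1. *)
Lemma expR_le_1B (R : realType) (q : R) : 0 <= q -> 2 * q <= 1 ->
  expR (- (q + 2 * q ^+ 2)) <= 1 - q.
Proof.
move=> q0 q2; rewrite expRN -div1r ler_pdivrMr ?expR_gt0 //.
apply: (@le_trans _ _ ((1 - q) * (1 + (q + 2 * q ^+ 2)))); last first.
  by rewrite ler_wpM2l ?expR_ge1Dx //; lra.
have : 0 <= q ^+ 2 * (1 - 2 * q) by rewrite mulr_ge0 ?exprn_ge0 //; lra.
rewrite -subr_ge0 => h; rewrite -subr_ge0; apply: le_trans h _.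
by rewrite le_eqVlt; apply/orP; left; apply/eqP; ring.
Qed.

Section DependencyProbabilities.
Variables (R : realType) (gT : finGroupType) (p : R).
Hypotheses (p_ge0 : 0 <= p) (p_le : 2 * p <= 1).
Implicit Types (x y : gT).

Local Notation n := (#|gT|%:R : R).
Local Notation prob := (avoid_prob p).
Local Notation ne x := (#|dep_edges x|%:R : R).
Local Notation nf x := (#|dep_forbidden x|%:R : R).

Let p_le1 : p <= 1. Proof. by move: p_ge0 p_le; lra. Qed.

Lemma dep_prob_ge x :
  expR (- ((p + 2 * p ^+ 2) * nf x + (p ^+ 2 + 2 * p ^+ 4) * ne x)) <=
  prob (dep_family x).
Proof.
apply: le_trans (avoid_prob_mul p_ge0 p_le1 _ _).
rewrite opprD addrC expRD; apply: ler_pM; rewrite ?expR_ge0 //.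
  apply: le_trans (avoid_prob_ge p_ge0 p_le1 _).
  rewrite (eq_bigr (fun=> 1 - p ^+ 2)) => [|A /card_dep_edge -> //].
  rewrite prodr_const -mulNr expRM_natr lerXn2r ?nnegrE ?expR_ge0 //.
    by rewrite subr_ge0 exprn_ile1.
  rewrite -[4%N]/(2 * 2)%N exprM; apply: expR_le_1B; first exact: exprn_ge0.
  by apply: le_trans p_le; rewrite ler_wpM2l // expr2 ler_piMr.
apply: le_trans (avoid_prob_ge p_ge0 p_le1 _).
rewrite (eq_bigr (fun=> 1 - p)) => [|A /imsetP[u _ ->]]; last by rewrite cards1 expr1.
rewrite prodr_const card_imset; last exact: finset.set1_inj.
by rewrite -mulNr expRM_natr lerXn2r ?nnegrE ?expR_ge0 ?expR_le_1B // subr_ge0.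
Qed.

(** Janson's upper bound for the union is compared with Harris' lower bounds for [x] and [y]. Shared
    forbidden elements cost [4 * p] and shared edges [p ^+ 2 * t]. In [36 * k], 32 pays for edges
    touching [L] and 4 for second-order vertex terms; in 544, 512 is Janson's correction and 32 the
    second-order edge terms. *)
Lemma dep_pair_prob_le x y (t k : R) :
  x != 1%g -> y != 1%g -> y != x -> y != x^-1%g ->
  nf x <= k -> nf y <= k -> #|dep_edges x :&: dep_edges y|%:R <= t ->
  prob (dep_family x :|: dep_family y) <=
    expR (4 * p + p ^+ 2 * (t + 36 * k) + 544 * n * p ^+ 3) *
    (prob (dep_family x) * prob (dep_family y)).
Proof.
move=> x1 y1 yx yxV xk yk ht.
pose L := dep_forbidden x :|: dep_forbidden y.
pose E := dep_edges x :|: dep_edges y.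
(* Edges touching a forbidden vertex are dropped, as [avoid_prob_le] asks for edges disjoint from
   [L]. *)
pose E' := [set A in E | A :&: L == finset.set0]%SET.
have hE' : E' :|: (finset.set1 @: L)%SET \subset dep_family x :|: dep_family y.
  rewrite /dep_family /L finset.imsetU finset.setUACA finset.setSU //.
  by apply/fintype.subsetP => A; rewrite inE => /andP[].
apply: le_trans (avoid_prob_anti p_ge0 p_le1 hE') _.
have deg u : (#|[set B in E' | u \in B]%SET| <= 16)%N.
  apply: leq_trans (leq_add (dep_degree x u) (dep_degree y u)).
  apply: leq_trans (leq_card_setU _ _); apply: subset_leq_card.
  by apply/fintype.subsetP => B; rewrite !inE => /andP[/andP[/orP[]-> _] ->]; rewrite ?orbT.
have E2 A : A \in E' -> #|A| = 2 /\ A :&: L = finset.set0.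
  by rewrite finset.inE => /andP[+ /eqP ->]; rewrite finset.inE => /orP[]/card_dep_edge ->.
apply: le_trans (avoid_prob_le p_ge0 p_le1 E2 deg) _.
have cL : nf x + nf y - 4 <= #|L|%:R.
  rewrite lerBlDr -!natrD ler_nat -cardsUI leq_add2l.
  exact: card_dep_forbiddenI.
have cL' : #|L|%:R <= 2 * k.
  have : #|L|%:R <= nf x + nf y by rewrite -natrD ler_nat leq_card_setU.
  by lra.
have cE : (#|E'|%:R : R) <= 16 * n.
  rewrite -natrM ler_nat; apply: (@leq_trans #|E|).
    by apply: subset_leq_card; apply/fintype.subsetP => A; rewrite inE => /andP[].
  apply: leq_trans (leq_card_setU _ _) _.
  by rewrite -[16%N]/(8 + 8)%N mulnDl leq_add ?card_dep_edges.
have cE' : ne x + ne y - t - 32 * k <= #|E'|%:R.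
  have h1 : ne x + ne y <= #|E|%:R + t.
    by rewrite -natrD -cardsUI natrD lerD2l.
  have h2 : (#|E|%:R : R) <= #|E'|%:R + 16 * #|L|%:R.
    rewrite -natrM -natrD ler_nat.
    rewrite -[#|E|](cardsID [set A : {set gT} | A :&: L == finset.set0]%SET).
    apply: leq_add.
      by apply: subset_leq_card; apply/fintype.subsetP => A; rewrite !inE.
    rewrite -[16%N]/(8 + 8)%N mulnDl.
    apply: leq_trans (leq_add (card_dep_edges_meet x L) (card_dep_edges_meet y L)).
    apply: leq_trans (leq_card_setU _ _); apply: subset_leq_card.
    by apply/fintype.subsetP => A; rewrite !inE => /andP[-> /orP[]->]; rewrite ?orbT.
  by lra.
have ub1 : (1 - p) ^+ #|L| <= expR (- p * #|L|%:R).
  by rewrite expRM_natr lerXn2r ?nnegrE ?expR_ge0 ?subr_ge0 // expR_ge1Dx.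
have q_le1 : p ^+ 2 * (1 - (2 * 16)%:R * p) <= 1.
  apply: (@le_trans _ _ (p ^+ 2 * 1)).
    by rewrite ler_wpM2l ?exprn_ge0 // lerBlDr lerDl mulr_ge0.
  by rewrite mulr1 exprn_ile1.
have ub2 : (1 - p ^+ 2 * (1 - (2 * 16)%:R * p)) ^+ #|E'| <=
    expR (- (p ^+ 2 * (1 - 32 * p)) * #|E'|%:R).
  by rewrite expRM_natr lerXn2r ?nnegrE ?expR_ge0 ?subr_ge0 // expR_ge1Dx.
apply: le_trans (ler_pM _ _ ub1 ub2) _; rewrite ?exprn_ge0 ?subr_ge0 //.
apply: le_trans (ler_wpM2l (expR_ge0 _) (ler_pM (expR_ge0 _) (expR_ge0 _)
  (dep_prob_ge x) (dep_prob_ge y))).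
rewrite -!expRD ler_expR.
have p2 : 0 <= p ^+ 2 by rewrite exprn_ge0.
have p3 : 0 <= p ^+ 3 by rewrite exprn_ge0.
have p4 : 0 <= p ^+ 4 by rewrite exprn_ge0.
have p43 : p ^+ 4 <= p ^+ 3 by rewrite exprSr ler_piMr.
have cx : ne x <= 8 * n by rewrite -natrM ler_nat card_dep_edges.
have cy : ne y <= 8 * n by rewrite -natrM ler_nat card_dep_edges.
rewrite -subr_ge0.
set N := n; set a := nf x; set b := nf y; set c := ne x; set d := ne y.
set e := (#|E'|%:R : R); set l := (#|L|%:R : R).
set D := (X in 0 <= X).
(* The difference of exponents is a sum of nonnegative slacks, one for each estimate above. *)
have -> : D = p * (l - (a + b - 4)) + p ^+ 2 * (e - (c + d - t - 32 * k)) +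
    2 * (p ^+ 2 * ((k - a) + (k - b))) + 32 * (p ^+ 3 * (16 * N - e)) +
    2 * (p ^+ 4 * ((8 * N - c) + (8 * N - d))) + 32 * (N * (p ^+ 3 - p ^+ 4)).
  by rewrite /D; ring.
have N0 : 0 <= N by rewrite ler0n.
apply: addr_ge0; [apply: addr_ge0; [apply: addr_ge0; [apply: addr_ge0; [apply: addr_ge0|]|]|]|].
- by apply: mulr_ge0 => //; rewrite subr_ge0.
- by apply: mulr_ge0 => //; rewrite subr_ge0.
- by do 2![apply: mulr_ge0 => //]; apply: addr_ge0; rewrite subr_ge0.
- by do 2![apply: mulr_ge0 => //]; rewrite subr_ge0.
- by do 2![apply: mulr_ge0 => //]; apply: addr_ge0; rewrite subr_ge0.
- by do 2![apply: mulr_ge0 => //]; rewrite subr_ge0.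
Qed.

Definition few_loops (m : R) : {set gT} :=
  [set x : gT | (x != 1%g) && ((nloops (dependency_graph x))%:R <= m)]%SET.

Lemma random_subset_PrE (D : pred {set gT}) :
  random_subset_Pr p D = expect p (fun S => (D S)%:R).
Proof.
rewrite /random_subset_Pr big_mkcond; apply: eq_bigr => S _.
by rewrite /subset_weight; case: (D S); rewrite ?mulr1 ?mulr0.
Qed.

Lemma diameter_gt2_prob_ge (m t : R) :
  let mu := \sum_(x in few_loops m) prob (dep_family x) in
  0 < t -> 0 < mu ->
  2 - expR (4 * p + p ^+ 2 * (t + 36 * (m + 2)) + 544 * n * p ^+ 3)
    - (64 * n / t + 2) / mu <=
  random_subset_Pr p (fun S : {set gT} => (2%:E < graph_diameter R (cayley_graph S))%E).
Proof.
move=> mu t0 mu0; rewrite random_subset_PrE.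
(* Besides large overlaps, [x] and [x^-1] count as bad partners, since [dep_pair_prob_le] excludes
   them; this is the [+ 2] in the bound. *)
pose bad x y := (y \in [set x; x^-1%g]%SET) || (t <= #|dep_edges x :&: dep_edges y|%:R).
have fm x : x \in few_loops m -> nf x <= m + 2.
  rewrite inE => /andP[_ h]; apply: (@le_trans _ _ ((nloops (dependency_graph x))%:R + 2)).
    by rewrite -natrD ler_nat card_dep_forbidden.
  by rewrite lerD2r.
apply: (second_moment p_ge0 p_le1 (X := few_loops m) (F := @dep_family gT)
  (bad := bad) _ _ _ (expR_ge0 _) mu0).
- move=> x S; rewrite inE => /andP[x1 _]; exact: dep_family_diameter.
- move=> x _; set P := [set y | t <= #|dep_edges x :&: dep_edges y|%:R]%SET.
  apply: (@le_trans _ _ (#|P|%:R + 2)); last first.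
    by rewrite lerD2r ler_pdivlMr // card_dep_overlap // ltW.
  rewrite -natrD ler_nat addnC.
  apply: (@leq_trans #|[set x; x^-1%g]%SET :|: P|).
    apply: subset_leq_card; apply/fintype.subsetP => y.
    rewrite finset.inE finset.in_setU => /andP[_ /orP[->//|h]].
    by apply/orP; right; rewrite finset.inE.
  apply: leq_trans (leq_card_setU _ _) _; rewrite leq_add2r cards2.
  by case: (_ != _).
- move=> x y xX yX; rewrite /bad finset.in_set2 !negb_or -!ltNge => /andP[/andP[yx yxV] /ltW h].
  have fx := fm x xX; have fy := fm y yX.
  move: xX yX; rewrite !finset.inE => /andP[x1 _] /andP[y1 _].
  exact: dep_pair_prob_le.
Qed.

End DependencyProbabilities.

(** * Comparison of the avoidance probabilities with [fG] *)

Section ExpectationBound.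
Variables (R : realType) (gT : finGroupType) (c d : R).
Hypotheses (c_gt0 : 0 < c) (d_ge0 : 0 <= d) (dc : d <= c).
Local Notation n := (#|gT|%:R : R).
Local Notation L := (ln n).
Local Notation r := (Num.sqrt (L / n)).
Local Notation p := (inclusion_prob gT d).
Local Notation m := (n * r / Num.sqrt c).

Let n_ge1 : 1 <= n.
Proof. by rewrite ler1n; apply/card_gt0P; exists 1%g. Qed.
Let n_gt0 : 0 < n. Proof. exact: lt_le_trans n_ge1. Qed.
Let L_ge0 : 0 <= L. Proof. exact: ln_ge0. Qed.
Let Ln_ge0 : 0 <= L / n. Proof. by rewrite divr_ge0 // ltW. Qed.

Lemma sqr_rate : r ^+ 2 = L / n. Proof. exact: sqr_sqrtr. Qed.

Lemma inclusion_probE : p = Num.sqrt d * r.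
Proof. by rewrite /inclusion_prob -mulrA sqrtrM. Qed.

Lemma fGxE (x : gT) : fGx x c =
  expR (- (c * #|dep_edges x|%:R * (L / n)
    + Num.sqrt c * (if (x ^+ 2 == 1)%g then 1 else 2) * r * (nloops (dependency_graph x))%:R)).
Proof.
rewrite opprD expRD /fGx; congr (_ * _).
  rewrite /gG -powRrM /powR gt_eqF // -[nedges _]/#|dep_edges x|.
  by congr expR; ring.
by rewrite /hG; case: ifP => _; rewrite -expRM; congr expR; ring.
Qed.

(** The threshold [m] satisfies [Num.sqrt c * r * m = L], so beyond it the loop factor alone is at
    most [n^-1]. *)
Lemma fGx_few_loops (x : gT) : m < (nloops (dependency_graph x))%:R -> fGx x c <= n^-1.
Proof.
move=> h; apply: (@le_trans _ _ (expR (- L))); last by rewrite expRN lnK ?posrE.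
rewrite fGxE ler_expR lerN2.
set l : R := (nloops _)%:R in h *.
have l0 : 0 <= l by rewrite /l ler0n.
have sc : 0 < Num.sqrt c by rewrite sqrtr_gt0.
have h1 : L <= Num.sqrt c * r * l.
  apply: (@le_trans _ _ (Num.sqrt c * r * m)).
    have -> : Num.sqrt c * r * m = n * r ^+ 2 by field; rewrite gt_eqF.
    by rewrite sqr_rate mulrCA mulfV ?mulr1 // gt_eqF.
  by rewrite ler_wpM2l ?(ltW h) ?mulr_ge0 ?sqrtr_ge0.
apply: le_trans h1 _; rewrite -[X in X <= _]add0r; apply: lerD.
  by rewrite mulr_ge0 // mulr_ge0 ?ler0n // ltW.
apply: (ler_wpM2r l0); apply: (ler_wpM2r (sqrtr_ge0 _)); rewrite ler_peMr ?sqrtr_ge0 //.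
by case: ifP => _ //; rewrite ler1n.
Qed.

Lemma fG_few_loops : fG gT c - 1 <= \sum_(x in few_loops gT m) fGx x c.
Proof.
rewrite /fG (bigID (fun x => (nloops (dependency_graph x))%:R <= m)) /=.
rewrite lerBlDr; apply: lerD.
  by rewrite le_eqVlt; apply/orP; left; apply/eqP/eq_bigl => x; rewrite inE.
apply: (@le_trans _ _ (\sum_(x : gT) n^-1)); last first.
  by rewrite sumr_const -[X in X <= _]mulr_natl mulfV // gt_eqF.
rewrite [X in X <= _]big_mkcond; apply: ler_sum => x _; case: ifP => [/andP[_]|_].
  by rewrite -ltNge; exact: fGx_few_loops.
by rewrite invr_ge0 ltW.
Qed.

(** Lowering [c] to [d] gains [(c - d) * (L / n)] per edge, and there are at least [n / 2] edges.
    The subtracted terms collect the second-order losses and the extra forbidden elements [x] and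
    [x^-1]. *)
Lemma dep_prob_fGx (x : gT) : 2 * p <= 1 -> x \in few_loops gT m ->
  expR ((c - d) / 2 * L - (2 * p + 2 * p ^+ 2 * (m + 2) + 16 * p ^+ 4 * n)) * fGx x c
  <= avoid_prob p (dep_family x).
Proof.
move=> p2; rewrite inE => /andP[x1 hl].
have p_ge0 : 0 <= p by rewrite sqrtr_ge0.
apply: le_trans (dep_prob_ge p_ge0 p2 x).
rewrite fGxE -expRD ler_expR.
set l : R := (nloops _)%:R in hl *.
have l0 : 0 <= l by rewrite /l ler0n.
have hf : #|dep_forbidden x|%:R <= l + 2 by rewrite -natrD ler_nat card_dep_forbidden.
have he : #|dep_edges x|%:R <= 8 * n by rewrite -natrM ler_nat card_dep_edges.
have he' : n <= 2 * #|dep_edges x|%:R by rewrite -natrM ler_nat card_dep_edges_ge.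
set f : R := #|dep_forbidden x|%:R in hf *.
set e : R := #|dep_edges x|%:R in he he' *.
have psq : p ^+ 2 = d * (L / n).
  by rewrite inclusion_probE exprMn sqr_rate sqr_sqrtr.
pose s : R := if (x ^+ 2 == 1)%g then 1 else 2.
have s1 : 1 <= s by rewrite /s; case: ifP => // _; rewrite ler1n.
(* The loop cost is paid by [hG], whose exponent carries the factor [s], 1 or 2. *)
have pl : p * l <= Num.sqrt c * s * r * l.
  rewrite inclusion_probE; apply: (ler_wpM2r l0); apply: (ler_wpM2r (sqrtr_ge0 _)).
  apply: le_trans (ler_wsqrtr dc) _; by rewrite ler_peMr ?sqrtr_ge0.
rewrite -/s.
have K1 : (p + 2 * p ^+ 2) * f <= (p + 2 * p ^+ 2) * (l + 2).
  by rewrite ler_wpM2l // addr_ge0 // mulr_ge0 ?exprn_ge0.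
have K2 : 2 * p ^+ 2 * l <= 2 * p ^+ 2 * m.
  by rewrite ler_wpM2l // mulr_ge0 ?exprn_ge0.
have K3 : 2 * p ^+ 4 * e <= 2 * p ^+ 4 * (8 * n).
  by rewrite ler_wpM2l // mulr_ge0 ?exprn_ge0.
have K4 : (c - d) / 2 * L <= (c - d) * (L / n) * e.
  have -> : (c - d) / 2 * L = (c - d) * (L / n) * (n / 2) by field; rewrite gt_eqF.
  rewrite ler_wpM2l ?ler_pdivrMr 1?mulrC //; first by rewrite mulr_ge0 ?subr_ge0.
have K5 : p ^+ 2 * e = d * (L / n) * e by rewrite psq.
rewrite -subr_ge0; set D := (X in 0 <= X).
have -> : D = ((p + 2 * p ^+ 2) * (l + 2) - (p + 2 * p ^+ 2) * f) +
    (Num.sqrt c * s * r * l - p * l) + (2 * p ^+ 2 * m - 2 * p ^+ 2 * l) +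
    (2 * p ^+ 4 * (8 * n) - 2 * p ^+ 4 * e) +
    ((c - d) * (L / n) * e - (c - d) / 2 * L) + (d * (L / n) * e - p ^+ 2 * e).
  by rewrite /D; ring.
rewrite K5 subrr addr0; move: K1 pl K2 K3 K4; rewrite -subr_ge0 => K1.
rewrite -[_ * l <= _]subr_ge0 => pl.
rewrite -[2 * _ * l <= _]subr_ge0 => K2; rewrite -[2 * _ * e <= _]subr_ge0 => K3.
rewrite -[_ <= _]subr_ge0 => K4.
by do 4![apply: addr_ge0 => //].
Qed.

End ExpectationBound.

(** * Asymptotics *)

(* In both error terms n is the order of the group, u = ln n * sqrt (ln n / n),
   v = 1 / ln n, a * (u * v) is the inclusion probability, and u / s is n^-1 ln n
   times the bound on the number of loops. *)
Definition ratio_error (R : realType) (a s u v : R) : R :=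
  4 * (a * (u * v)) + a ^+ 2 * v + 36 * (a ^+ 2 * (u / s + 2 * (u * v) ^+ 2))
  + 544 * (a ^+ 3 * u).

Definition mean_error (R : realType) (a s u v : R) : R :=
  2 * (a * (u * v)) + 2 * (a ^+ 2 * (u / s + 2 * (u * v) ^+ 2))
  + 16 * (a ^+ 4 * (u ^+ 2 * v)).

(** * Explicit lower bound for one group *)

Section DiameterBound.
Variables (R : realType) (gT : finGroupType) (c d : R).
Hypotheses (c_gt0 : 0 < c) (d_ge0 : 0 <= d) (dc : d < c).
Local Notation n := (#|gT|%:R : R).
Local Notation L := (ln n).
Local Notation r := (Num.sqrt (L / n)).
Local Notation p := (inclusion_prob gT d).
Local Notation m := (n * r / Num.sqrt c).
Local Notation u := (L * r).
Local Notation v := (L^-1).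
Local Notation a := (Num.sqrt d).
Local Notation s := (Num.sqrt c).

Lemma diameter_gt2_prob_fG : 0 < L -> 2 * p <= 1 -> 2 <= fG gT c ->
  mean_error (Num.sqrt d) (Num.sqrt c) u v <= 1 ->
  2 - expR (ratio_error (Num.sqrt d) (Num.sqrt c) u v)
    - expR 1 * 6 / ((c - d) / 2) ^+ 3 * (64 * v + 2 * v ^+ 3) <=
  random_subset_Pr p (fun S : {set gT} => (2%:E < graph_diameter R (cayley_graph S))%E).
Proof.
move=> L0 p2 f2.
have p_ge0 : 0 <= p by rewrite sqrtr_ge0.
have n0 : 0 < n by rewrite ltr0n; apply/card_gt0P; exists 1%g.
have rE : r ^+ 2 = L / n by apply: sqr_rate.
have nrr : n * r ^+ 2 = L by rewrite rE mulrCA mulfV ?mulr1 // gt_eqF.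
have pE : p = Num.sqrt d * r by apply: inclusion_probE.
have Ln0 : L != 0 by rewrite gt_eqF.
have uv : u * v = r by rewrite mulrC mulrA mulVf // mul1r.
have sc : Num.sqrt c != 0 by rewrite gt_eqF // sqrtr_gt0.
have nr3 : n * r ^+ 3 = u by rewrite exprSr mulrA nrr.
have p2m : p ^+ 2 * m = a ^+ 2 * (u / s).
  by rewrite pE -nr3; field.
have -> : mean_error a s u v = 2 * p + 2 * p ^+ 2 * (m + 2) + 16 * p ^+ 4 * n.
  have e : u ^+ 2 * v = n * r ^+ 4.
    by rewrite expr2 -mulrA uv -nr3; ring.
  rewrite /mean_error uv e !mulrDr -[2 * p ^+ 2 * m]mulrA p2m pE; ring.
have -> : ratio_error a s u v =
    4 * p + p ^+ 2 * (n / L ^+ 2 + 36 * (m + 2)) + 544 * n * p ^+ 3.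
  have e : a ^+ 2 * v = p ^+ 2 * (n / L ^+ 2).
    rewrite pE exprMn rE; field; by rewrite Ln0 gt_eqF.
  rewrite /ratio_error uv e -nr3 in p2m *.
  have -> : p ^+ 2 * (n / L ^+ 2 + 36 * (m + 2)) =
    p ^+ 2 * (n / L ^+ 2) + 36 * (p ^+ 2 * m) + 72 * p ^+ 2 by ring.
  rewrite p2m pE; ring.
set delta := (c - d) / 2.
have delta0 : 0 < delta by rewrite divr_gt0 // subr_gt0.
set W := 2 * p + _ + _ => W1.
(* The errors cost at most a factor [expR 1], and [fG gT c - 1] is at least 1. *)
have mu_ge : expR (delta * L - 1) <= \sum_(x in few_loops gT m) avoid_prob p (dep_family x).
  apply: (@le_trans _ _ (expR (delta * L - W) * (fG gT c - 1))).
    rewrite -[X in X <= _]mulr1; apply: ler_pM; rewrite ?expR_ge0 ?ler_expR //.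
      by rewrite lerD2l lerN2.
    by move: f2; lra.
  apply: (@le_trans _ _ (expR (delta * L - W) * \sum_(x in few_loops gT m) fGx x c)).
    by rewrite ler_wpM2l ?expR_ge0 //; apply: fG_few_loops.
  rewrite big_distrr /=; apply: ler_sum => x xX.
  by apply: dep_prob_fGx => //; apply: ltW.
(* With overlap threshold [n / L ^+ 2] the term [p ^+ 2 * t] is [d / L], which vanishes, and only
   [64 * L ^+ 2 + 2] partners are bad. *)
have t0 : 0 < n / L ^+ 2 by rewrite divr_gt0 // exprn_gt0.
have mu0 := lt_le_trans (expR_gt0 _) mu_ge.
apply: le_trans (diameter_gt2_prob_ge p_ge0 p2 t0 mu0).
rewrite lerD2l lerN2.
have -> : 64 * n / (n / L ^+ 2) + 2 = 64 * L ^+ 2 + 2.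
  by field; rewrite Ln0 gt_eqF.
have v0 : 0 <= v by rewrite invr_ge0 ltW.
have B0 : 0 <= 64 * v + 2 * v ^+ 3.
  by apply: addr_ge0; apply: mulr_ge0 => //; apply: exprn_ge0.
have d3 : 0 <= delta ^+ 3 by apply: exprn_ge0; apply: ltW.
rewrite ler_pdivrMr //; apply: le_trans (ler_wpM2l _ mu_ge); last first.
  by apply: mulr_ge0 => //; apply: divr_ge0 => //; apply: mulr_ge0; rewrite ?expR_ge0.
(* The cubic term of the exponential series already dominates the quadratic number of bad
   partners. *)
have e3 : (delta * L) ^+ 3 / 6 <= expR (delta * L).
  apply: le_trans (expR_ge1Dxn 2 _); last by rewrite mulr_ge0 // ltW.
  by rewrite lerDr ler01.
have -> : 64 * L ^+ 2 + 2 = (64 * v + 2 * v ^+ 3) * (6 / delta ^+ 3) * ((delta * L) ^+ 3 / 6).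
  by field; rewrite Ln0 gt_eqF.
have -> : expR 1 * 6 / delta ^+ 3 * (64 * v + 2 * v ^+ 3) * expR (delta * L - 1) =
  (64 * v + 2 * v ^+ 3) * (6 / delta ^+ 3) * expR (delta * L).
  rewrite expRD expRN; field; by rewrite Ln0 gt_eqF // gt_eqF // expR_gt0.
apply: ler_wpM2l e3.
by apply: mulr_ge0 => //; apply: divr_ge0.
Qed.

(** Here [u ^+ 2 = L ^+ 3 / n], and the quartic term of the exponential series gives
    [n >= L ^+ 4 / 24]. *)
Lemma rate_le : 0 < L -> u <= Num.sqrt (24 * v).
Proof.
move=> L0; have n0 : 0 < n by rewrite ltr0n; apply/card_gt0P; exists 1%g.
have -> : u = Num.sqrt (L ^+ 3 / n).
  rewrite -{1}(ger0_norm (ltW L0)) -sqrtr_sqr -sqrtrM ?sqr_ge0 //.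
  by congr Num.sqrt; ring.
apply: ler_wsqrtr; rewrite ler_pdivrMr //.
have : L ^+ 4 / 24 <= n.
  rewrite -[X in _ <= X]lnK ?posrE //.
  by apply: le_trans (expR_ge1Dxn 3 (ltW L0)); rewrite lerDr.
rewrite ler_pdivrMr // => h.
rewrite -(ler_pM2l L0) -exprS; apply: le_trans h _.
by rewrite le_eqVlt; apply/orP; left; apply/eqP; field; rewrite gt_eqF.
Qed.

End DiameterBound.

Local Open Scope classical_set_scope.

(** * Vanishing of the error terms: every monomial contains [u] or [v] *)

Section ErrorLimits.
Context {R : realType} {T : Type} {F : set_system T} {FF : Filter F}.
Variables (a s : R) (u v : T -> R).
Hypotheses (u0 : u k @[k --> F] --> (0 : R)) (v0 : v k @[k --> F] --> (0 : R)).

Let cst (b : R) : (fun=> b) @ F --> b. Proof. exact: cvg_cst. Qed.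
Arguments cst b [t].

Lemma cvg_ratio_error : ratio_error a s (u k) (v k) @[k --> F] --> (0 : R).
Proof.
have := cvgD (cvgD (cvgD (cvgM (cst 4) (cvgM (cst a) (cvgM u0 v0))) (cvgM (cst (a ^+ 2)) v0))
  (cvgM (cst 36) (cvgM (cst (a ^+ 2)) (cvgD (cvgM u0 (cst s^-1))
    (cvgM (cst 2) (cvgM (cvgM u0 v0) (cvgM u0 v0))))))) (cvgM (cst 544) (cvgM (cst (a ^+ 3)) u0)).
by rewrite !(mul0r, mulr0, addr0) => h; exact: h.
Qed.

Lemma cvg_mean_error : mean_error a s (u k) (v k) @[k --> F] --> (0 : R).
Proof.
have := cvgD (cvgD (cvgM (cst 2) (cvgM (cst a) (cvgM u0 v0)))
  (cvgM (cst 2) (cvgM (cst (a ^+ 2)) (cvgD (cvgM u0 (cst s^-1))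
    (cvgM (cst 2) (cvgM (cvgM u0 v0) (cvgM u0 v0)))))))
  (cvgM (cst 16) (cvgM (cst (a ^+ 4)) (cvgM (cvgM u0 u0) v0))).
by rewrite !(mul0r, mulr0, addr0) => h; exact: h.
Qed.

End ErrorLimits.

Theorem theorem2p2 (R : realType) (c : R) (c_gt0 : 0 < c)
    (G : nat -> finGroupType)
    (cardG_infty : #|G k| @[k --> \oo] --> \oo)
    (fG_infty : forall eps : R, 0 < eps -> eps < c ->
       fG (G k) (c - eps) @[k --> \oo] --> +oo) :
  forall eps : R, 0 < eps -> eps <= c ->
    random_subset_Pr (inclusion_prob (G k) (c - eps))
      (fun S : {set G k} => (2%:E < graph_diameter R (cayley_graph S))%E)
      @[k --> \oo] --> (1 : R).
Proof.
move=> eps eps0 epsc.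
(* The hypothesis on [fG] is used at [c'], halfway between [d] and [c]. It stays positive even when
   [eps = c], and the gap [c' - d = eps / 2] provides the power of [n]. *)
pose d := c - eps; pose c' := c - eps / 2.
have c'0 : 0 < c' by rewrite /c'; lra.
have d0 : 0 <= d by rewrite /d; lra.
have dc' : d < c' by rewrite /d /c'; lra.
have fG' : fG (G k) c' @[k --> \oo] --> +oo by apply: fG_infty; lra.
pose L k : R := ln #|G k|%:R.
pose u k : R := L k * Num.sqrt (L k / #|G k|%:R).
pose v k : R := (L k)^-1.
have Loo : L k @[k --> \oo] --> +oo.
  apply/cvgryPge => A; have /cvgrnyP/cvgryPge/(_ (expR A)) := cardG_infty.
  apply: filterS => k h; rewrite -[A]expRK ler_ln // ?posrE ?expR_gt0 //.
  exact: lt_le_trans (expR_gt0 A) h.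
have L_gt0 : \forall k \near \oo, 0 < L k.
  by apply: filterS (cvgry_ge Loo 1) => k; apply: lt_le_trans.
have v0 : v k @[k --> \oo] --> (0 : R) by apply/(gtr0_cvgV0 L_gt0).
have u0 : u k @[k --> \oo] --> (0 : R).
  apply: (@squeeze_cvgr _ _ _ _ (fun=> 0) (fun k => Num.sqrt (24 * v k))).
  - apply: filterS L_gt0 => k L0; apply/andP; split; last exact: rate_le.
    by rewrite mulr_ge0 ?sqrtr_ge0 // ltW.
  - exact: cvg_cst.
  - have h : 24 * v k @[k --> \oo] --> (0 : R).
      by rewrite -(mulr0 24); apply: cvgM v0; apply: cvg_cst.
    rewrite -sqrtr0; apply: continuous_cvg h; exact: sqrt_continuous.
have mean0 : mean_error (Num.sqrt d) (Num.sqrt c') (u k) (v k) @[k --> \oo] --> (0 : R).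
  exact: cvg_mean_error.
have ratio0 : ratio_error (Num.sqrt d) (Num.sqrt c') (u k) (v k) @[k --> \oo] --> (0 : R).
  exact: cvg_ratio_error.
have p0 : 2 * inclusion_prob (G k) d @[k --> \oo] --> (0 : R).
  have h : 2 * (Num.sqrt d * (u k * v k)) @[k --> \oo] --> (2 * (Num.sqrt d * (0 * 0)) : R).
    by apply: cvgM; [exact: cvg_cst | apply: cvgM; [exact: cvg_cst | exact: cvgM]].
  rewrite !mulr0 in h; apply: cvg_trans h; apply: near_eq_cvg.
  apply: filterS L_gt0 => k L0; rewrite inclusion_probE //.
  by congr (2 * (_ * _)); rewrite /u /v [L k * _]mulrC mulfK ?gt_eqF.
have mean1 : \forall k \near \oo,
    mean_error (Num.sqrt d) (Num.sqrt c') (u k) (v k) <= 1.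
  by apply: (cvgr_le _ mean0).
pose K := expR 1 * 6 / ((c' - d) / 2) ^+ 3.
(* The probability lies between the explicit bound, which tends to [2 - expR 0 - 0 = 1], and 1. *)
apply: (@squeeze_cvgr _ _ _ _
  (fun k => 2 - expR (ratio_error (Num.sqrt d) (Num.sqrt c') (u k) (v k))
     - K * (64 * v k + 2 * v k ^+ 3)) (fun=> 1)).
- near=> k; apply/andP; split.
    apply: diameter_gt2_prob_fG => //.
    + by near: k.
    + by near: k; apply: (cvgr_le _ p0).
    + by near: k; apply: cvgry_ge.
    + by near: k.
  rewrite random_subset_PrE -[X in _ <= X](@expect_cst R (G k) (inclusion_prob (G k) d) 1).
  have P0 : 0 <= inclusion_prob (G k) d by rewrite sqrtr_ge0.
  apply: le_expect => // [|S]; last by rewrite lern1 leq_b1.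
  suff : 2 * inclusion_prob (G k) d <= 1 by move: P0; lra.
  by near: k; apply: (cvgr_le _ p0).
- have e : expR (ratio_error (Num.sqrt d) (Num.sqrt c') (u k) (v k)) @[k --> \oo] --> expR 0.
    by apply: continuous_cvg ratio0; exact: continuous_expR.
  have h : K * (64 * v k + 2 * v k ^+ 3) @[k --> \oo] --> K * (64 * 0 + 2 * (0 * (0 * 0))).
    apply: cvgM; first exact: cvg_cst.
    apply: cvgD; apply: cvgM; try exact: cvg_cst; first exact: v0.
    exact: cvgM v0 (cvgM v0 v0).
  have two : (fun=> 2) @ \oo --> (2 : R) by exact: cvg_cst.
  have E : 2 - expR 0 - K * (64 * 0 + 2 * (0 * (0 * 0))) = 1 :> R by rewrite expR0; ring.
  have lim := cvgB (cvgB two e) h; rewrite E in lim; exact: lim.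
- exact: cvg_cst.
Unshelve. all: by end_near.
Qed.
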